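(* For all integers $n>1$, $c\ge 1$ and $0\le k\le (c-1)n+c\binom{n}{2}$, we have $i_c(n,k)=i_c\!\left(n,(c-1)n+c\binom{n}{2}-k\right)$.
   Context: For integers $n\ge1$, $c\ge1$, let $G_{c,n}$ be the set of colored permutations: words $\sigma=\sigma_1^{[c_1]}\cdots\sigma_n^{[c_n]}$ where $|\sigma|=\sigma_1\cdots\sigma_n$ is a permutation of $[n]$ and each color $c_i\in\{0,\dots,c-1\}$. For a permutation $\pi$ of $[n]$, $\mathrm{inv}(\pi)=|\{(i,j):i<j,\ \pi_i>\pi_j\}|$. Let $\mathrm{col}(\sigma)=c_1+\cdots+c_n$ and $\mathrm{inv}_c(\sigma)=\mathrm{inv}(|\sigma|)+\mathrm{col}(\sigma)+c\cdot|\{(i,j):1\le i<j\le n,\ \sigma_i<\sigma_j,\ c_j\ne0\}|$. Define $i_c(n,k)=|\{\sigma\in G_{c,n}:\mathrm{inv}_c(\sigma)=k\}|$. *)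

(* Defs.v *)
From mathcomp Require Import all_boot all_fingroup.

Set Implicit Arguments.
Unset Strict Implicit.
Unset Printing Implicit Defensive.

(* The word s_1^[c_1] ... s_n^[c_n] is the pair (|s|, color word). Positions
   and letters are numbered from 0 (in 'I_n) instead of from 1; the statistics
   below only depend on their order. *)
Definition colored_perm (c n : nat) : finType :=
  ('S_n * {ffun 'I_n -> 'I_c})%type.

Section Statistics.

Variables c n : nat.
Implicit Types (p : 'S_n) (s : colored_perm c n).

Definition inv p : nat :=
  #|[set ij : 'I_n * 'I_n | (ij.1 < ij.2) && (p ij.2 < p ij.1)]|.

Definition abs_perm s : 'S_n := s.1.

Definition color s (i : 'I_n) : nat := s.2 i.

Definition col s : nat := \sum_(i < n) color s i.

Definition inv_c s : nat :=
  inv (abs_perm s) + col s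
  + c * #|[set ij : 'I_n * 'I_n |
            [&& ij.1 < ij.2,
                abs_perm s ij.1 < abs_perm s ij.2 &
                color s ij.2 != 0]]|.

End Statistics.

Definition num_inv_c (c n k : nat) : nat :=
  #|[set s : colored_perm c n | inv_c s == k]|.

(* Main.v *)
Require Import Defs.
From mathcomp Require Import all_boot all_fingroup.
From mathcomp Require Import zify.

(** Put [a_j = #{i < j | p_i > p_j}]. Then [inv_c] is the sum over [j] of
    [w_j = a_j + c_j + c (j - a_j) [c_j <> 0]]. For fixed [j] the pair
    [(a_j, c_j)], with [a_j <= j] and [c_j < c], is determined by [w_j], which
    ranges over [0, c (j + 1)); as [p] is determined by its code [a], counting
    shows that [w] is a bijection from colored permutations onto
    [\prod_j [0, c (j + 1))]. Reflecting every coordinate of this box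
    complements [inv_c]. *)

Set Implicit Arguments.
Unset Strict Implicit.
Unset Printing Implicit Defensive.

Definition lehmer n (p : 'S_n) (j : 'I_n) : nat :=
  #|[set i : 'I_n | (i < j) && (p j < p i)]|.

Lemma card_ord_lt n (j : 'I_n) : #|[set i : 'I_n | i < j]| = j.
Proof.
have -> : [set i : 'I_n | i < j] = widen_ord (ltnW (ltn_ord j)) @: [set: 'I_j].
  apply/setP=> i; rewrite !inE; apply/idP/imsetP => [lt_ij | [k _ ->]].
    by exists (Ordinal lt_ij) => //; apply: val_inj.
  exact: (ltn_ord k).
rewrite card_imset ?cardsT ?card_ord // => k l /(congr1 val) eq_kl.
exact: val_inj.
Qed.

Lemma lehmer_noninv n (p : 'S_n) (j : 'I_n) :
  lehmer p j + #|[set i : 'I_n | (i < j) && (p i < p j)]| = j.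
Proof.
rewrite -[RHS]card_ord_lt -(cardsID [set i : 'I_n | p j < p i] [set i : 'I_n | i < j]).
congr (_ + _); apply: eq_card => i; rewrite !inE // andbC.
case: (ltnP i j) => [lt_ij|]; rewrite ?andbF //= andbT -leqNgt.
have ne_ij : i != j by rewrite -val_eqE ltn_eqF.
by rewrite ltn_neqAle val_eqE (inj_eq perm_inj) ne_ij andbT.
Qed.

Lemma lehmer_le n (p : 'S_n) (j : 'I_n) : lehmer p j <= j.
Proof. by rewrite -[leqRHS](lehmer_noninv p j) leq_addr. Qed.

(** As [p] and [q] agree after [j], they use the same letters at positions up to [j]. So each larger
    letter that [q] has before [q j] is also counted for [p], and so is [q j] itself, which [q] does
    not count. *)
Lemma lehmer_ltn n (p q : 'S_n) (j : 'I_n) :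
  (forall i : 'I_n, j < i -> p i = q i) -> p j < q j -> lehmer q j < lehmer p j.
Proof.
move=> eq_pq lt_pq.
(* Counting letters instead of positions makes the two codes cardinals of comparable sets. *)
have lehmerE (r : 'S_n) : lehmer r j = #|[set y : 'I_n | (r^-1%g y < j) && (r j < y)]|.
  rewrite /lehmer -(card_imset _ (@perm_inj _ r)); apply: eq_card => y.
  apply/imsetP/idP => [[i] | ]; rewrite !inE; first by move=> ? ->; rewrite permK.
  by move=> ?; exists (r^-1%g y); rewrite ?inE permKV.
(* In [p], the letter [y] is not at [j], since it exceeds [p j], and not after [j], where [q] would
   have it at the same place. *)
have pV_lt y : q^-1%g y <= j -> p j < y -> p^-1%g y < j.
  move=> qy_le lt_y; rewrite ltnNge leq_eqVlt; apply/norP; split.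
    by apply: contraTneq lt_y => /val_inj ->; rewrite permKV ltnn.
  apply/negP=> lt_j; have := eq_pq _ lt_j; rewrite permKV => yE.
  by move: qy_le; rewrite yE permK leqNgt lt_j.
rewrite !lehmerE; apply: proper_card; apply/properP; split.
  apply/subsetP=> y; rewrite !inE => /andP[qy_lt lt_y].
  have lt_py := ltn_trans lt_pq lt_y.
  by rewrite lt_py pV_lt // ltnW.
by exists (q j); rewrite !inE ?ltnn ?andbF // lt_pq pV_lt // permK.
Qed.

Lemma lehmer_inj n (p q : 'S_n) : lehmer p =1 lehmer q -> p = q.
Proof.
(* Induction on a bound for [n - j] recovers the letters from the last position backwards; the bound
   0 is vacuous since [j < n]. *)
move=> eq_code; suff eq_pq m (j : 'I_n) : n - j <= m -> p j = q j.
  by apply/permP=> j; apply: eq_pq (leqnn _).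
elim: m j => [|m IHm] j le_m; first by have := ltn_ord j; lia.
have eq_gt (i : 'I_n) : j < i -> p i = q i.
  by move=> lt_ji; apply: IHm; have := ltn_ord i; lia.
case: (ltngtP (p j) (q j)) => [lt_pq | lt_qp | /val_inj //].
  by have := lehmer_ltn eq_gt lt_pq; rewrite eq_code ltnn.
have eq_gtC (i : 'I_n) : j < i -> q i = p i by move/eq_gt.
by have := lehmer_ltn eq_gtC lt_qp; rewrite eq_code ltnn.
Qed.

Definition weight (c j a x : nat) : nat := a + x + c * ((x != 0) * (j - a)).

Lemma weight_lt c j a x : a <= j -> x < c -> weight c j a x < c * j.+1.
Proof. by rewrite /weight; case: x => [|x] /=; nia. Qed.

(** Color 0 gives the weight [a <= j], while a nonzero color gives [j + x + (c - 1) * (j - a)],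
    which exceeds [j]. In the latter case [x - 1 < c - 1], so [j - a] and [x - 1] are the quotient
    and remainder of a division by [c - 1]. *)
Lemma weight_inj c j a x b y : a <= j -> b <= j -> x < c -> y < c ->
  weight c j a x = weight c j b y -> a = b /\ x = y.
Proof.
rewrite /weight => le_a le_b; case: x => [|x]; case: y => [|y] /= lt_x lt_y.
- lia.
- nia.
- nia.
rewrite !mul1n => eq_w.
have : j - a = j - b by case: (ltngtP (j - a) (j - b)) => // ?; nia.
move=> eq_ab; rewrite eq_ab in eq_w; lia.
Qed.

Lemma card_pairs n (P : 'I_n -> 'I_n -> bool) :
  #|[set ij : 'I_n * 'I_n | P ij.1 ij.2]| = \sum_(j < n) #|[set i | P i j]|.
Proof.
rewrite -sum1dep_card -(pair_big_dep xpredT P (fun _ _ => 1)) /=.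
under eq_bigr do rewrite big_mkcond.
rewrite exchange_big; apply: eq_bigr => j _.
by rewrite -big_mkcond sum1dep_card.
Qed.

Lemma inv_c_sum c n (s : colored_perm c n) :
  inv_c s = \sum_(j < n) weight c j (lehmer (abs_perm s) j) (color s j).
Proof.
have invE : Defs.inv (abs_perm s) = \sum_(j < n) lehmer (abs_perm s) j
  := card_pairs (fun i j => (i < j) && (abs_perm s j < abs_perm s i)).
rewrite /inv_c invE /col /weight !big_split -big_distrr /=.
congr (_ + _ + c * _).
rewrite (card_pairs (fun i j : 'I_n => [&& i < j, abs_perm s i < abs_perm s j
  & color s j != 0])).
apply: eq_bigr => j _.
(* The factor [j - a] of the weight is the number of non-inversions ending at [j]; the color
   condition depends on [j] alone, so it keeps all of them or none. *)
rewrite -[X in X - _](lehmer_noninv (abs_perm s) j) addKn.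
case: (color s j != 0); rewrite ?mul1n ?mul0n.
  by apply: eq_card => i; rewrite !inE andbT.
by apply: eq_card0 => i; rewrite !inE !andbF.
Qed.

Section WeightBox.

Variables c n : nat.

Definition weight_box := {dffun forall j : 'I_n, 'I_(c * j.+1)}.

Definition weights (s : colored_perm c n) : weight_box :=
  [ffun j => Ordinal (weight_lt (lehmer_le (abs_perm s) j) (ltn_ord (s.2 j)))].

Lemma weights_inj : injective weights.
Proof.
move=> [p x] [q y] /ffunP eq_w.
have eq_pxqy (j : 'I_n) : lehmer p j = lehmer q j /\ x j = y j :> nat.
  apply: (@weight_inj c j); rewrite ?lehmer_le //.
  by have := eq_w j; rewrite !ffunE => /(congr1 val).
congr (_, _); first by apply: lehmer_inj => j; case: (eq_pxqy j).
by apply/ffunP=> j; apply: val_inj; case: (eq_pxqy j).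
Qed.

(** Both cardinals are [c ^ n * n]!, the box contributing the product of the [c * j.+1]. *)
Lemma card_weight_box : #|{: weight_box}| = #|{: colored_perm c n}|.
Proof.
rewrite card_dep_ffun foldrE big_map big_enum /=.
under eq_bigr do rewrite card_ord.
rewrite big_split /= prod_nat_const card_prod card_ffun !card_ord mulnC.
by rewrite card_Sn fact_prod big_add1 big_mkord.
Qed.

Lemma weights_bij : bijective weights.
Proof. by apply: inj_card_bij weights_inj _; rewrite card_weight_box. Qed.

Definition reflect_box (w : weight_box) : weight_box :=
  [ffun j => rev_ord (w j)].

Lemma reflect_boxK : involutive reflect_box.
Proof. by move=> w; apply/ffunP=> j; rewrite !ffunE rev_ordK. Qed.

Lemma inv_c_weights s : inv_c s = \sum_(j < n) weights s j.
Proof. by rewrite inv_c_sum; apply: eq_bigr => j _; rewrite ffunE. Qed.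

Lemma sum_reflect_box (w : weight_box) :
  \sum_(j < n) w j + \sum_(j < n) reflect_box w j = (c - 1) * n + c * 'C(n, 2).
Proof.
rewrite -big_split /=.
(* A coordinate and its reflection add up to the largest value of the range, [c * j.+1 - 1]. *)
transitivity (\sum_(j < n) ((c - 1) + c * j)).
  apply: eq_bigr => j _; rewrite ffunE /=; have := ltn_ord (w j).
  by case: c (w j) => [|c'] v; nia.
by rewrite big_split /= sum_nat_const card_ord mulnC -big_distrr /= -bin2_sum big_mkord.
Qed.

End WeightBox.

Theorem theorem3p1 (n c k : nat) (hn : 1 < n) (hc : 1 <= c)
    (hk : k <= (c - 1) * n + c * 'C(n, 2)) :
  num_inv_c c n k = num_inv_c c n ((c - 1) * n + c * 'C(n, 2) - k).
Proof.
have [g wK gK] := weights_bij c n.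
(* Reflection of the box, transported to colored permutations along the bijection. *)
pose f s := g (reflect_box (weights s)).
have fK : involutive f by move=> s; rewrite /f gK reflect_boxK wK.
have inv_cf s : inv_c s + inv_c (f s) = (c - 1) * n + c * 'C(n, 2).
  by rewrite !inv_c_weights gK sum_reflect_box.
rewrite /num_inv_c -(card_imset _ (inv_inj fK)); apply: eq_card => s.
rewrite !inE -{1}(fK s) (mem_imset _ _ (inv_inj fK)) inE.
(* By [hk] the truncated subtraction of [k] is exact, so [inv_c (f s) = k] amounts to the
   complementary value at [s]. *)
by have := inv_cf s; lia.
Qed.
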